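(* Let $\mathcal{MV}_s$ be the category of semisimple MV-algebras and $\mathcal{RMV}_s$ the category of semisimple Riesz MV-algebras. Let $\mathbf U:\mathcal{RMV}_s\to\mathcal{MV}_s$ be the forgetful functor (forgetting scalar multiplication) and let $\mathbf R:\mathcal{MV}_s\to\mathcal{RMV}_s$ be the Riesz hull functor. Then $(\mathbf R,\mathbf U)$ is an adjoint pair, with $\mathbf R$ left adjoint to $\mathbf U$.
   Context: An MV-algebra is a structure $(A,\oplus,{}^*,0)$ such that $(A,\oplus,0)$ is an abelian monoid, $(a^* )^*=a$, $0^*\oplus a=0^*$ and $(a^*\oplus b)^*\oplus b=(b^*\oplus a)^*\oplus a$. Put $1=0^*$, $a\odot b=(a^*\oplus b^* )^*$; $a\le b$ iff $a\odot b^*=0$. An ideal is a nonempty downward closed subset closed under $\oplus$; $A$ is semisimple if the intersection of its maximal (proper) ideals is $\{0\}$. A Riesz MV-algebra is an MV-algebra $V$ with a map $\cdot:[0,1]\times V\to V$ such that $r(a\odot b^* )=(ra)\odot(rb)^*$, $\max(r-q,0)\,a=(ra)\odot(qa)^*$, $(rq)a=r(qa)$, $1a=a$ for all $r,q\in[0,1]$, $a,b\in V$. It is semisimple if its MV-algebra reduct is. MV-homomorphisms between Riesz MV-algebras automatically preserve scalar multiplication; morphisms in both categories are the MV-homomorphisms. Riesz hull: for an abelian lattice-ordered group $G$ with strong unit $u$, $\Gamma(G,u)$ is the MV-algebra $[0,u]$ with $x\oplus y=(x+y)\wedge u$, $x^*=u-x$; every MV-algebra is of this form up to isomorphism. If $A=\Gamma(G,u)$,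 its divisible hull is $A_d=\Gamma(G_d,u)$, where $G_d=\{g/n\mid g\in G,\ n\ge1\}$ is the divisible hull of $G$. The Dedekind-MacNeille completion $\hat B$ of a semisimple MV-algebra $B$ is the (unique up to isomorphism) MV-algebra containing $B$ as a subalgebra, complete as a lattice, in which every element is a supremum of elements of $B$. For $A$ semisimple, $A_d$ is semisimple and $\widehat{A_d}$ carries a (unique) Riesz MV-algebra structure. The Riesz hull $\mathbf R(A)$ is the Riesz MV-subalgebra of $\widehat{A_d}$ generated by the image of $A$ under the composite of canonical embeddings $A\to A_d\to\widehat{A_d}$, and $\iota_A:A\to\mathbf R(A)$ is this composite with codomain restricted to $\mathbf R(A)$. On morphisms: for an MV-homomorphism $h:A\to B$ of semisimple MV-algebras, $\mathbf R(h):\mathbf R(A)\to\mathbf R(B)$ is the unique homomorphism such that $\mathbf U(\mathbf R(h))\circ\iota_A=\iota_B\circ h$. *)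

(* Defs.v *)
From HB Require Import structures.
From mathcomp Require Import all_boot all_order all_algebra.
From mathcomp Require Import boolp classical_sets reals interval_inference.

Set Implicit Arguments.
Unset Strict Implicit.
Unset Printing Implicit Defensive.

Import Order.TTheory GRing.Theory Num.Theory.
Local Open Scope classical_set_scope.
Local Open Scope ring_scope.

Declare Scope mv_scope.
Delimit Scope mv_scope with mv.
Local Open Scope mv_scope.

HB.mixin Record isMVAlgebra A := {
  mv_zero : A;
  mv_add : A -> A -> A;
  mv_neg : A -> A;
  mv_addA : associative mv_add;
  mv_addC : commutative mv_add;
  mv_add0 : left_id mv_zero mv_add;
  mv_negK : involutive mv_neg;
  mv_add1 : forall a, mv_add (mv_neg mv_zero) a = mv_neg mv_zero;
  mv_luk : forall a b,
    mv_add (mv_neg (mv_add (mv_neg a) b)) b =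
    mv_add (mv_neg (mv_add (mv_neg b) a)) a
}.

#[short(type="mvAlgType")]
HB.structure Definition MVAlgebra := {A of isMVAlgebra A}.

Notation "a ⊕ b" := (mv_add a b) (at level 50, left associativity) : mv_scope.
Notation "¬ a" := (mv_neg a) (at level 35, right associativity) : mv_scope.

Definition mv_mul (A : mvAlgType) (a b : A) : A := ¬ (¬ a ⊕ ¬ b).
Notation "a ⊙ b" := (mv_mul a b) (at level 40, left associativity) : mv_scope.

Definition mv_le (A : mvAlgType) (a b : A) : Prop := a ⊙ ¬ b = mv_zero.

Record mv_hom (A B : mvAlgType) := MVHom {
  mv_fun :> A -> B;
  mv_hom0 : mv_fun mv_zero = mv_zero;
  mv_homD : forall a b, mv_fun (a ⊕ b) = mv_fun a ⊕ mv_fun b;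
  mv_homN : forall a, mv_fun (¬ a) = ¬ mv_fun a
}.

Lemma mv_hom_eq (A B : mvAlgType) (f g : mv_hom A B) : f =1 g -> f = g.
Proof.
case: f g => [f f0 fD fN] [g g0 gD gN] /= /funext fg; subst g.
by congr MVHom; exact: Prop_irrelevance.
Qed.

Definition mv_id (A : mvAlgType) : mv_hom A A :=
  @MVHom A A idfun erefl (fun _ _ => erefl) (fun _ => erefl).

Section Composition.
Variables (A B C : mvAlgType) (g : mv_hom B C) (f : mv_hom A B).

Let comp0 : (g \o f) mv_zero = mv_zero.
Proof. by rewrite /= !mv_hom0. Qed.
Let compD a b : (g \o f) (a ⊕ b) = (g \o f) a ⊕ (g \o f) b.
Proof. by rewrite /= !mv_homD. Qed.
Let compN a : (g \o f) (¬ a) = ¬ (g \o f) a.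
Proof. by rewrite /= !mv_homN. Qed.

Definition mv_comp : mv_hom A C := MVHom comp0 compD compN.
End Composition.

Lemma mv_compA (A B C D : mvAlgType) (h : mv_hom C D) (g : mv_hom B C)
  (f : mv_hom A B) : mv_comp h (mv_comp g f) = mv_comp (mv_comp h g) f.
Proof. exact: mv_hom_eq. Qed.

Lemma mv_comp1l (A B : mvAlgType) (f : mv_hom A B) : mv_comp (mv_id B) f = f.
Proof. exact: mv_hom_eq. Qed.

Lemma mv_comp1r (A B : mvAlgType) (f : mv_hom A B) : mv_comp f (mv_id A) = f.
Proof. exact: mv_hom_eq. Qed.

Definition mv_ideal (A : mvAlgType) (I : set A) : Prop :=
  [/\ I !=set0,
      forall a b, mv_le a b -> I b -> I a &
      forall a b, I a -> I b -> I (a ⊕ b)].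

Definition mv_maximal_ideal (A : mvAlgType) (M : set A) : Prop :=
  [/\ mv_ideal M, M != setT &
      forall J, mv_ideal J -> J != setT -> M `<=` J -> J = M].

Definition semisimple (A : mvAlgType) : Prop :=
  \bigcap_(M in @mv_maximal_ideal A) M = [set mv_zero].

HB.mixin Record isRieszMV (R : realType) V of MVAlgebra V := {
  mv_scale : {i01 R} -> V -> V;
  mv_scaleB : forall (r : {i01 R}) (a b : V),
    mv_scale r (a ⊙ ¬ b) = mv_scale r a ⊙ ¬ mv_scale r b;
  mv_scaleBl : forall (r q : {i01 R}) (a : V),
    mv_scale (Num.max (r%:num - q%:num) 0)%:i01 a
    = mv_scale r a ⊙ ¬ mv_scale q a;
  mv_scaleA : forall (r q : {i01 R}) (a : V),
    mv_scale (r%:num * q%:num)%:i01 a = mv_scale r (mv_scale q a);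
  mv_scale1 : forall a : V, mv_scale 1%:i01 a = a
}.

#[short(type="rieszMVType")]
HB.structure Definition RieszMV (R : realType) :=
  {V of MVAlgebra V & isRieszMV R V}.

Definition riesz_subalgebra (R : realType) (V : rieszMVType R) (S : set V) :
    Prop :=
  [/\ S mv_zero,
      forall a b, S a -> S b -> S (a ⊕ b),
      forall a, S a -> S (¬ a) &
      forall (r : {i01 R}) a, S a -> S (mv_scale r a)].

(* The joins of [Order.Lattice] with the ring hierarchy are not declared in the
   library, so the lattice operations are added to [porderZmodType] here. *)
HB.mixin Record isLatticeGroup G of Num.POrderedZmodule G := {
  lmeet : G -> G -> G;
  ljoin : G -> G -> G;
  lgroup_lexI : forall x y z : G, (x <= lmeet y z) = (x <= y) && (x <= z);
  lgroup_leUx : forall x y z : G, (ljoin x y <= z) = (x <= z) && (y <= z);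
  lgroup_leD2l : forall x y z : G, x <= y -> z + x <= z + y
}.

#[short(type="lGroupType")]
HB.structure Definition LatticeGroup :=
  {G of Num.POrderedZmodule G & isLatticeGroup G}.

Record ulgroup := ULGroup {
  ulgroup_sort :> lGroupType;
  ulunit : ulgroup_sort;
  ulunit_ge0 : 0 <= ulunit;
  ulunit_strong : forall x, exists n : nat, x <= ulunit *+ n
}.
Arguments ulunit : clear implicits.

Record ul_hom (G H : ulgroup) := ULHom {
  ul_fun :> G -> H;
  ul_homD : forall x y, ul_fun (x + y) = ul_fun x + ul_fun y;
  ul_homI : forall x y, ul_fun (lmeet x y) = lmeet (ul_fun x) (ul_fun y);
  ul_homU : forall x y, ul_fun (ljoin x y) = ljoin (ul_fun x) (ul_fun y);
  ul_hom_unit : ul_fun (ulunit G) = ulunit H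
}.

Section LatticeGroupTheory.
Variable G : lGroupType.
Implicit Types x y z : G.

Lemma lgroup_leIl x y : lmeet x y <= x.
Proof. by have := lexx (lmeet x y); rewrite lgroup_lexI => /andP[]. Qed.

Lemma lgroup_leIr x y : lmeet x y <= y.
Proof. by have := lexx (lmeet x y); rewrite lgroup_lexI => /andP[]. Qed.

Lemma lgroup_leUl x y : x <= ljoin x y.
Proof. by have := lexx (ljoin x y); rewrite lgroup_leUx => /andP[]. Qed.

Lemma lgroup_leUr x y : y <= ljoin x y.
Proof. by have := lexx (ljoin x y); rewrite lgroup_leUx => /andP[]. Qed.

Lemma lgroup_meetC x y : lmeet x y = lmeet y x.
Proof. by apply/le_anti; rewrite !lgroup_lexI !lgroup_leIl !lgroup_leIr. Qed.

Lemma lgroup_joinC x y : ljoin x y = ljoin y x.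
Proof. by apply/le_anti; rewrite !lgroup_leUx !lgroup_leUl !lgroup_leUr. Qed.

Lemma lgroup_meetA x y z : lmeet x (lmeet y z) = lmeet (lmeet x y) z.
Proof.
by apply/le_anti/andP; split; rewrite !lgroup_lexI ?andbA -?andbA; apply/and3P; split;
  do ?[exact: lgroup_leIl | exact: lgroup_leIr
     | exact: le_trans (lgroup_leIl _ _) (lgroup_leIl _ _)
     | exact: le_trans (lgroup_leIl _ _) (lgroup_leIr _ _)
     | exact: le_trans (lgroup_leIr _ _) (lgroup_leIl _ _)
     | exact: le_trans (lgroup_leIr _ _) (lgroup_leIr _ _)].
Qed.

Lemma lgroup_meet_idPl x y : reflect (lmeet x y = x) (x <= y).
Proof.
apply: (iffP idP) => [xy|<-]; last exact: lgroup_leIr.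
by apply/le_anti; rewrite lgroup_leIl lgroup_lexI lexx.
Qed.

Lemma lgroup_leD2r x y z : x <= y -> x + z <= y + z.
Proof. by rewrite ![_ + z]addrC; exact: lgroup_leD2l. Qed.

Lemma lgroup_leN x y : x <= y -> - y <= - x.
Proof.
by move=> /(lgroup_leD2l x y (- x - y)); rewrite addrNK addrAC addNr add0r.
Qed.

Lemma lgroup_addr_ge0 x y : 0 <= x -> 0 <= y -> 0 <= x + y.
Proof.
by move=> x0 /(lgroup_leD2l 0 y x); rewrite addr0; exact: le_trans.
Qed.

Lemma lgroup_subr_ge0 x y : x <= y -> 0 <= y - x.
Proof. by move=> /(@lgroup_leD2r _ _ (- x)); rewrite subrr. Qed.

Lemma lgroup_meetDr x y z :
  lmeet x y + z = lmeet (x + z) (y + z).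
Proof.
apply/le_anti/andP; split.
  by rewrite lgroup_lexI !lgroup_leD2r ?lgroup_leIl ?lgroup_leIr.
rewrite -[X in X <= _](addrNK z); apply: lgroup_leD2r.
by rewrite lgroup_lexI; apply/andP; split; rewrite -[leRHS](addrK z) lgroup_leD2r
  ?lgroup_leIl ?lgroup_leIr.
Qed.

Lemma lgroup_oppI x y : - lmeet x y = ljoin (- x) (- y).
Proof.
apply/le_anti/andP; split; last first.
  by rewrite lgroup_leUx !lgroup_leN ?lgroup_leIl ?lgroup_leIr.
rewrite -[X in _ <= X]opprK; apply: lgroup_leN.
by rewrite lgroup_lexI; apply/andP; split; rewrite -[leRHS]opprK lgroup_leN
  ?lgroup_leUl ?lgroup_leUr.
Qed.

Lemma lgroup_joinDr x y z :
  ljoin x y + z = ljoin (x + z) (y + z).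
Proof.
have joinE (a b : G) : ljoin a b = - lmeet (- a) (- b) by rewrite lgroup_oppI !opprK.
rewrite !joinE !opprD -lgroup_meetDr opprD opprK //.
Qed.

End LatticeGroupTheory.

Definition Gamma (G : ulgroup) : Type := {x : G | 0 <= x <= ulunit G}.

Definition gamma_of (G : ulgroup) (x : G) (hx : 0 <= x <= ulunit G) : Gamma G :=
  exist (fun x : G => 0 <= x <= ulunit G) x hx.

Section Gamma.
Variable G : ulgroup.
Implicit Types x y z : Gamma G.

Let zero_subproof : (0 : G) <= 0 <= ulunit G.
Proof. by rewrite lexx ulunit_ge0. Qed.
Definition gamma_zero : Gamma G := gamma_of zero_subproof.

Let add_subproof x y :
  (0 : G) <= lmeet (val x + val y) (ulunit G) <= ulunit G.
Proof.
case: x y => x /= /andP[x0 _] [y /= /andP[y0 _]].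
by rewrite lgroup_lexI lgroup_addr_ge0 // ulunit_ge0 lgroup_leIr.
Qed.
Definition gamma_add x y : Gamma G := gamma_of (add_subproof x y).

Let neg_subproof x : (0 : G) <= ulunit G - val x <= ulunit G.
Proof.
case: x => x /= /andP[x0 xu]; rewrite lgroup_subr_ge0 //=.
by rewrite -[leRHS]addr0 (lgroup_leD2l _ 0) // -oppr0 lgroup_leN.
Qed.
Definition gamma_neg x : Gamma G := gamma_of (neg_subproof x).

Let addC : commutative gamma_add.
Proof. by move=> x y; apply: val_inj; rewrite /= addrC. Qed.

Let addA_aux x y z :
  val (gamma_add (gamma_add x y) z)
  = lmeet (val x + val y + val z) (ulunit G).
Proof.
rewrite /= lgroup_meetDr -lgroup_meetA; congr lmeet.
rewrite lgroup_meetC; apply/lgroup_meet_idPl; rewrite -[leLHS]addr0; apply: lgroup_leD2l.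
by case: z => z /= /andP[].
Qed.

Let addA : associative gamma_add.
Proof.
move=> x y z; apply: val_inj.
by rewrite addA_aux addC addA_aux addrC addrA.
Qed.

Let add0 : left_id gamma_zero gamma_add.
Proof.
move=> x; apply: val_inj; rewrite /= add0r; apply/lgroup_meet_idPl.
by case: x => x /= /andP[].
Qed.

Let negK : involutive gamma_neg.
Proof. by move=> x; apply: val_inj; rewrite /= opprB addrC subrK. Qed.

Let add1 x : gamma_add (gamma_neg gamma_zero) x = gamma_neg gamma_zero.
Proof.
apply: val_inj; rewrite /= subr0 lgroup_meetC; apply/lgroup_meet_idPl.
by rewrite -[leLHS]addr0; apply: lgroup_leD2l; case: x => x /= /andP[].
Qed.

Let luk_aux x y :
  val (gamma_add (gamma_neg (gamma_add (gamma_neg x) y)) y)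
  = ljoin (val x) (val y).
Proof.
have -> : val (gamma_add (gamma_neg (gamma_add (gamma_neg x) y)) y)
  = lmeet (ulunit G - lmeet (ulunit G - val x + val y) (ulunit G) + val y)
               (ulunit G) by [].
rewrite lgroup_oppI [ulunit G + ljoin _ _]addrC !lgroup_joinDr addNr add0r.
have -> : - (ulunit G - val x + val y) + ulunit G + val y = val x.
  by rewrite opprD opprB addrAC !subrK.
apply/lgroup_meet_idPl; rewrite lgroup_leUx.
by case: x y => x /= /andP[_ ->] [y /= /andP[_ ->]].
Qed.

Let luk x y :
  gamma_add (gamma_neg (gamma_add (gamma_neg x) y)) y =
  gamma_add (gamma_neg (gamma_add (gamma_neg y) x)) x.
Proof. by apply: val_inj; rewrite !luk_aux lgroup_joinC. Qed.

HB.instance Definition _ :=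
  isMVAlgebra.Build (Gamma G) addA addC add0 negK add1 luk.

End Gamma.

Section GammaMap.
Variables (G H : ulgroup) (j : ul_hom G H).

Let j0 : j 0 = 0.
Proof. by apply: (addIr (j 0)); rewrite -ul_homD !add0r. Qed.

Let jN x : j (- x) = - j x.
Proof. by apply: (addIr (j x)); rewrite -ul_homD !addNr j0. Qed.

Let jle x y : x <= y -> j x <= j y.
Proof. by move=> /lgroup_meet_idPl xy; apply/lgroup_meet_idPl; rewrite -ul_homI xy. Qed.

Let map_subproof (x : Gamma G) : 0 <= j (val x) <= ulunit H.
Proof.
case: x => x /= /andP[x0 xu].
by rewrite -{1}j0 -[ulunit H](ul_hom_unit j) !jle.
Qed.

Definition gamma_fun (x : Gamma G) : Gamma H := gamma_of (map_subproof x).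

Let map0 : gamma_fun mv_zero = mv_zero.
Proof. exact: val_inj. Qed.
Let mapD x y : gamma_fun (x ⊕ y) = gamma_fun x ⊕ gamma_fun y.
Proof. by apply: val_inj; rewrite /= ul_homI ul_homD ul_hom_unit. Qed.
Let mapN x : gamma_fun (¬ x) = ¬ gamma_fun x.
Proof. by apply: val_inj; rewrite /= ul_homD jN ul_hom_unit. Qed.

Definition gamma_map : mv_hom (Gamma G) (Gamma H) := MVHom map0 mapD mapN.

End GammaMap.

(* [j] identifies [G] with a subgroup of the divisible group [Gd] all of
   whose elements are of the form [j g / n] with [1 <= n]. *)
Definition is_divisible_hull (G Gd : ulgroup) (j : ul_hom G Gd) : Prop :=
  [/\ injective j,
      forall (x : Gd) (n : nat), (0 < n)%N -> exists y : Gd, y *+ n = x &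
      forall x : Gd, exists (g : G) (n : nat), (0 < n)%N /\ x *+ n = j g].

Definition mv_is_sup (A : mvAlgType) (S : set A) (s : A) : Prop :=
  (forall a, S a -> mv_le a s) /\
  (forall b, (forall a, S a -> mv_le a b) -> mv_le s b).

Definition mv_is_inf (A : mvAlgType) (S : set A) (s : A) : Prop :=
  (forall a, S a -> mv_le s a) /\
  (forall b, (forall a, S a -> mv_le b a) -> mv_le b s).

Definition mv_complete (A : mvAlgType) : Prop :=
  forall S : set A, (exists s, mv_is_sup S s) /\ (exists s, mv_is_inf S s).

Definition is_DM_completion (B C : mvAlgType) (e : mv_hom B C) : Prop :=
  [/\ injective e,
      mv_complete C &
      forall c : C, exists S : set B, mv_is_sup (e @` S) c].

(* [V] with [iota] is a Riesz hull of [A]: for some presentation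
   [phi : A ~ Gamma G], divisible hull [j] and completion [e], the algebra [V]
   is isomorphic through [k] to the Riesz subalgebra of the completion [C]
   generated by the image of [A], and [iota] is the corestriction of the
   composite embedding. The Riesz structure of [C] is not chosen: it is unique
   on a completion of the MV-algebra of a divisible group. All of these data
   are unique up to isomorphism. *)
Definition is_riesz_hull (R : realType) (A : mvAlgType) (V : rieszMVType R)
    (iota : mv_hom A V) : Prop :=
  exists (G : ulgroup) (phi : mv_hom A (Gamma G))
         (Gd : ulgroup) (j : ul_hom G Gd)
         (C : rieszMVType R) (e : mv_hom (Gamma Gd) C)
         (k : mv_hom V C),
    let emb := mv_comp e (mv_comp (gamma_map j) phi) in
    [/\ bijective phi, is_divisible_hull j & is_DM_completion e] /\
    [/\ injective k,
        forall (r : {i01 R}) (v : V), k (mv_scale r v) = mv_scale r (k v),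
        range k = smallest (@riesz_subalgebra R C) (range emb) &
        forall a, k (iota a) = emb a].

Record category := Category {
  obj :> Type;
  hom : obj -> obj -> Type;
  idc : forall a, hom a a;
  compc : forall a b c, hom b c -> hom a b -> hom a c;
  compcA : forall a b c d (h : hom c d) (g : hom b c) (f : hom a b),
    compc h (compc g f) = compc (compc h g) f;
  compc1l : forall a b (f : hom a b), compc (idc b) f = f;
  compc1r : forall a b (f : hom a b), compc f (idc a) = f
}.

Notation "a ⟶ b" := (hom a b) (at level 90, right associativity) : mv_scope.
Notation "g ∘ f" := (compc g f) (at level 40, left associativity) : mv_scope.

(* Functors are indexed by their object map. *)
Record functor (C D : category) (F : C -> D) := Functor {
  fmap : forall a b, (a ⟶ b) -> (F a ⟶ F b);
  fmap_id : forall a, fmap (idc a) = idc (F a);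
  fmap_comp : forall a b c (g : b ⟶ c) (f : a ⟶ b),
    fmap (g ∘ f) = fmap g ∘ fmap f
}.

Definition left_adjoint (C D : category) (L0 : C -> D) (U0 : D -> C)
    (L : functor L0) (U : functor U0) : Prop :=
  exists theta : forall (c : C) (d : D), (L0 c ⟶ d) -> (c ⟶ U0 d),
    (forall c d, bijective (@theta c d)) /\
    (forall c c' d d' (h : c' ⟶ c) (k : d ⟶ d') (f : L0 c ⟶ d),
      theta c' d' (k ∘ f ∘ fmap L h) = fmap U k ∘ theta c d f ∘ h).

Record ssMV := SSMV {
  ssMV_sort :> mvAlgType;
  ssMV_semisimple : semisimple ssMV_sort
}.

Record ssRieszMV (R : realType) := SSRieszMV {
  ssRieszMV_sort :> rieszMVType R;
  ssRieszMV_semisimple : semisimple ssRieszMV_sort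
}.

Definition MVs : category :=
  @Category ssMV (fun A B => mv_hom A B) (fun A => mv_id A)
    (fun _ _ _ g f => mv_comp g f)
    (fun _ _ _ _ h g f => mv_compA h g f)
    (fun _ _ f => mv_comp1l f) (fun _ _ f => mv_comp1r f).

Definition RMVs (R : realType) : category :=
  @Category (ssRieszMV R) (fun A B => mv_hom A B) (fun A => mv_id A)
    (fun _ _ _ g f => mv_comp g f)
    (fun _ _ _ _ h g f => mv_compA h g f)
    (fun _ _ f => mv_comp1l f) (fun _ _ f => mv_comp1r f).

Definition forget_obj (R : realType) (V : RMVs R) : MVs :=
  @SSMV (ssRieszMV_sort V) (ssRieszMV_semisimple V).

Definition forget (R : realType) : functor (@forget_obj R) :=
  @Functor (RMVs R) MVs (@forget_obj R) (fun _ _ f => f)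
    (fun _ => erefl) (fun _ _ _ _ _ => erefl).

(* Main.v *)
(* Everything is read off characters, i.e. MV-homomorphisms into [0,1]. A
   character is determined by its kernel and is homogeneous for the scalars of
   a Riesz MV-algebra; every maximal ideal [N] of a Riesz MV-algebra is the
   kernel of a character, which sends [v] to the supremum of the [t] with
   [t1 <= v] modulo [N]. Hence characters separate the points of a semisimple
   Riesz MV-algebra [W]. Given a Riesz hull [iota : A -> V] and [f : A -> W],
   each character [chi] of [W] has a partner [psi] on [V] with
   [psi o iota = chi o f]: extend the ideal of [V] generated by the image of the
   kernel of [chi o f], which is proper as [iota] is injective, to a maximal
   ideal. The elements [v] admitting a [w] with [psi v = chi w] for all such
   pairs form a Riesz subalgebra containing [iota A], hence all of [V], and
   [v |-> w] is the unique extension of [f]. This universal property of [iota]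
   is the adjunction. *)
Require Import Defs.
From mathcomp Require Import all_boot all_order all_algebra.
From mathcomp Require Import boolp classical_sets reals interval_inference.
From mathcomp Require Import lra.

Set Implicit Arguments.
Unset Strict Implicit.
Unset Printing Implicit Defensive.

Import Order.TTheory GRing.Theory Num.Theory.
Local Open Scope classical_set_scope.
Local Open Scope ring_scope.
Local Open Scope mv_scope.

Local Notation "a ⊖ b" := (a ⊙ ¬ b) (at level 40, left associativity).

(** * Arithmetic and order in an MV-algebra *)

Section MVTheory.
Variable A : mvAlgType.
Implicit Types a b c d x y : A.

Lemma mv_addr0 a : a ⊕ mv_zero = a.
Proof. by rewrite mv_addC mv_add0. Qed.

Lemma mv_addNr a : ¬ a ⊕ a = ¬ mv_zero.
Proof.
have := mv_luk a (¬ mv_zero).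
by rewrite mv_negK mv_add0 => <-; rewrite mv_addC mv_add1.
Qed.

Lemma mv_mulC a b : a ⊙ b = b ⊙ a.
Proof. by rewrite /mv_mul mv_addC. Qed.

Lemma mv_mulA a b c : a ⊙ (b ⊙ c) = a ⊙ b ⊙ c.
Proof. by rewrite /mv_mul !mv_negK mv_addA. Qed.

Lemma mv_mulr0 a : a ⊙ mv_zero = mv_zero.
Proof. by rewrite mv_mulC /mv_mul mv_add1 mv_negK. Qed.

Lemma mv_mulrN a : a ⊖ a = mv_zero.
Proof. by rewrite /mv_mul mv_negK mv_addNr mv_negK. Qed.

Lemma mv_sub0 a : a ⊖ mv_zero = a.
Proof. by rewrite /mv_mul mv_negK mv_addr0 mv_negK. Qed.

Lemma mv_subN a b : ¬ b ⊖ ¬ a = a ⊖ b.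
Proof. by rewrite mv_negK mv_mulC. Qed.

Lemma mv_subA a b c : a ⊖ b ⊖ c = a ⊖ (b ⊕ c).
Proof. by rewrite -mv_mulA /mv_mul !mv_negK. Qed.

(** Both sides are the meet of [a] and [b]; this is [mv_luk] conjugated by negation. *)
Lemma mv_meetC a b : a ⊙ (¬ a ⊕ b) = b ⊙ (¬ b ⊕ a).
Proof.
rewrite /mv_mul; congr mv_neg; rewrite mv_addC [¬ a ⊕ b]mv_addC.
have := mv_luk (¬ b) (¬ a); rewrite !mv_negK => ->.
by rewrite mv_addC [a ⊕ _]mv_addC.
Qed.

Lemma mv_le_sub a b c : mv_le (a ⊖ b) c <-> mv_le a (b ⊕ c).
Proof. by rewrite /mv_le mv_subA. Qed.

Lemma mv_le0_eq a : mv_le a mv_zero -> a = mv_zero.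
Proof. by rewrite /mv_le mv_sub0. Qed.

Lemma mv_leP a b : mv_le a b <-> exists c, b = a ⊕ c.
Proof.
split=> [ab|[c ->]]; last by rewrite /mv_le -mv_subA mv_mulrN mv_mulC mv_mulr0.
(* By [mv_luk], [(b ⊖ a) ⊕ a] equals [(a ⊖ b) ⊕ b], which is [b] once [a ⊖ b] vanishes. *)
exists (b ⊖ a); have := mv_luk a b; move: ab; rewrite /mv_le /mv_mul !mv_negK.
by move=> ->; rewrite mv_add0 [¬ b ⊕ a]mv_addC mv_addC [a ⊕ ¬ b]mv_addC.
Qed.

Lemma mv_lexx a : mv_le a a.
Proof. exact: mv_mulrN. Qed.

Lemma mv_le0 a : mv_le mv_zero a.
Proof. by rewrite /mv_le mv_mulC mv_mulr0. Qed.

Lemma mv_le_trans b a c : mv_le a b -> mv_le b c -> mv_le a c.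
Proof.
move=> /mv_leP[d ->] /mv_leP[e ->]; apply/mv_leP.
by exists (d ⊕ e); rewrite mv_addA.
Qed.

Lemma mv_le_anti a b : mv_le a b -> mv_le b a -> a = b.
Proof.
have := mv_luk a b; rewrite /mv_le /mv_mul !mv_negK => + ab ba.
by rewrite ab ba !mv_add0.
Qed.

Lemma mv_leD a b c d : mv_le a b -> mv_le c d -> mv_le (a ⊕ c) (b ⊕ d).
Proof.
move=> /mv_leP[e ->] /mv_leP[f ->]; apply/mv_leP; exists (e ⊕ f).
by rewrite -!mv_addA; congr (_ ⊕ _); rewrite !mv_addA [e ⊕ c]mv_addC.
Qed.

Lemma mv_leN a b : mv_le a b -> mv_le (¬ b) (¬ a).
Proof. by rewrite /mv_le mv_subN. Qed.

Lemma mv_leM a b c d : mv_le a b -> mv_le c d -> mv_le (a ⊙ c) (b ⊙ d).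
Proof. by move=> ab cd; apply/mv_leN/mv_leD; exact: mv_leN. Qed.

Lemma mv_le1 a : mv_le a (¬ mv_zero).
Proof. by rewrite /mv_le mv_negK mv_mulr0. Qed.

Lemma mv_leMl a b : mv_le (a ⊙ b) a.
Proof. by rewrite /mv_le mv_mulC mv_mulA [¬ a ⊙ a]mv_mulC mv_mulrN mv_mulC mv_mulr0. Qed.

Lemma mv_leMr a b : mv_le (a ⊙ b) b.
Proof. by rewrite mv_mulC; exact: mv_leMl. Qed.

Lemma mv_le_subK a b : mv_le a (b ⊕ (a ⊖ b)).
Proof. by apply/mv_le_sub/mv_lexx. Qed.

Lemma mv_sub_trans b a c : mv_le (a ⊖ c) ((a ⊖ b) ⊕ (b ⊖ c)).
Proof.
apply/mv_le_sub; rewrite [_ ⊖ b ⊕ _]mv_addC mv_addA mv_addC.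
apply: (mv_le_trans (mv_le_subK a b)).
by rewrite mv_addC; apply: mv_leD; [exact: mv_lexx | exact: mv_le_subK].
Qed.

Lemma mv_subD a b c d : mv_le ((a ⊕ b) ⊖ (c ⊕ d)) ((a ⊖ c) ⊕ (b ⊖ d)).
Proof.
apply/mv_le_sub; apply: mv_le_trans (mv_leD (mv_le_subK a c) (mv_le_subK b d)) _.
rewrite -!mv_addA; apply: mv_leD (mv_lexx _) _.
rewrite !mv_addA [_ ⊖ c ⊕ d]mv_addC; exact: mv_lexx.
Qed.

(** The two opposite differences have meet zero, so subtracting one from the other changes nothing.
    This is what makes maximal ideals prime. *)
Lemma mv_sub_disjoint a b : (a ⊖ b) ⊖ (b ⊖ a) = a ⊖ b.
Proof.
set c := a ⊖ b; set d := b ⊖ a; set z := a ⊕ c.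
(* This is the meet of [c] and [d]; by [mv_meetC] its vanishing says [mv_le c (c ⊖ d)]. *)
suff c0 : d ⊙ (¬ d ⊕ c) = mv_zero.
  apply: mv_le_anti; first exact: mv_leMl.
  have e : ¬ (c ⊖ d) = ¬ c ⊕ d by rewrite /mv_mul !mv_negK.
  by rewrite /mv_le e mv_meetC.
(* Two exchanges of meets: [d ⊙ (¬ b ⊕ z)] is the [⊙]-product of [¬ a] with the meet of [b] and [z],
   and [¬ a ⊙ z] is the meet of [¬ a] and [c]. *)
have -> : d ⊙ (¬ d ⊕ c) = (c ⊙ (¬ c ⊕ ¬ a)) ⊙ (¬ z ⊕ b).
  have -> : ¬ d ⊕ c = ¬ b ⊕ z.
    by rewrite [RHS]mv_addA; congr (_ ⊕ _); rewrite /d /mv_mul !mv_negK.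
  rewrite /d [b ⊙ _]mv_mulC -mv_mulA mv_meetC mv_mulA; congr (_ ⊙ _).
  by rewrite mv_meetC mv_negK.
apply: mv_le0_eq; apply: (@mv_le_trans (a ⊙ (¬ b ⊙ (¬ z ⊕ b)))).
  by rewrite mv_mulA; apply: mv_leM (mv_leMl _ _) (mv_lexx _).
have -> : ¬ b ⊙ (¬ z ⊕ b) = ¬ z ⊙ (z ⊕ ¬ b).
  have := mv_meetC (¬ b) (¬ z).
  by rewrite !mv_negK [b ⊕ _]mv_addC.
apply: mv_le_trans (mv_leM (mv_lexx a) (mv_leMl _ _)) _.
by rewrite /z -mv_subA mv_mulrN mv_mulC mv_mulr0; exact: mv_lexx.
Qed.

Definition mv_iter k a : A := iter k (mv_add a) mv_zero.

Lemma mv_iterS k a : mv_iter k.+1 a = a ⊕ mv_iter k a.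
Proof. by []. Qed.

Lemma mv_iterD k l a : mv_iter (k + l) a = mv_iter k a ⊕ mv_iter l a.
Proof. by elim: k => [|k IH]; rewrite ?mv_add0 // addSn !mv_iterS IH mv_addA. Qed.

Lemma mv_sub_iter k a b : a ⊖ b = a -> a ⊖ mv_iter k b = a.
Proof.
by move=> ab; elim: k => [|k IH]; rewrite ?mv_sub0 // mv_iterS -mv_subA ab.
Qed.

End MVTheory.

(** * Ideals and maximal ideals *)

Section Ideals.
Variable A : mvAlgType.
Implicit Types (a b c : A) (I M : set A).

Lemma mv_ideal0 I : mv_ideal I -> I mv_zero.
Proof. by case=> [[a Ia] dn _]; apply: dn Ia; exact: mv_le0. Qed.

Lemma mv_ideal_proper I : mv_ideal I -> I != setT -> ~ I (¬ mv_zero).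
Proof.
move=> [_ dn _] /eqP + I1; apply.
by rewrite -subTset => a _; apply: dn I1; exact: mv_le1.
Qed.

Lemma mv_properN I : ~ I (¬ mv_zero) -> I != setT.
Proof. by move=> + ; apply: contra_notT; rewrite negbK => /eqP ->. Qed.

Lemma mv_maximal_exists I : mv_ideal I -> ~ I (¬ mv_zero) ->
  exists2 M, mv_maximal_ideal M & I `<=` M.
Proof.
move=> idI I1.
(* Testing [J] together with [I], instead of [J] alone, makes the union of the empty chain satisfy
   [P]. *)
pose P (J : set A) := mv_ideal (J `|` I) /\ ~ (J `|` I) (¬ mv_zero).
have /Zorn_bigcup[M [[idM M1] maxM]] : forall F : set (set A),
    F `<=` P -> total_on F subset -> P (\bigcup_(X in F) X).
  move=> F FP tot; split; last first.
    by move=> [[X FX X1]|//]; case: (FP X FX) => _; apply; left.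
  split.
  - by exists mv_zero; right; exact: mv_ideal0.
  - move=> a b ab [[X FX Xb]|Ib]; last by right; case: idI => _ dn _; exact: dn Ib.
    case: (FP X FX) => [[_ dn _] _].
    by case: (dn a b ab (or_introl Xb)) => ?; [left; exists X | right].
  move=> a b Ha Hb.
  have addF X : F X -> (X `|` I) a -> (X `|` I) b ->
      (\bigcup_(X in F) X `|` I) (a ⊕ b).
    move=> FX Xa Xb; case: (FP X FX) => [[_ _ ad] _].
    by case: (ad a b Xa Xb) => ?; [left; exists X | right].
  case: Ha => [[X FX Xa]|Ia]; case: Hb => [[Y FY Yb]|Ib].
  - by case: (tot X Y FX FY) => XY; [apply: (addF Y) | apply: (addF X)] => //;
      left => //; exact: XY.
  - by apply: (addF X) => //; [left | right].
  - by apply: (addF Y) => //; [right | left].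
  - by right; case: idI => _ _; exact.
exists (M `|` I); last by move=> a; right.
split=> //; first exact: mv_properN.
move=> J idJ J1 MJ; apply: contrapT => JM.
apply: (maxM J); last first.
  have JI : J `|` I = J by apply/setUidPl => a Ia; apply: MJ; right.
  by rewrite /P JI; split=> //; exact: mv_ideal_proper.
split; first by move=> a Ma; apply: MJ; left.
by move=> JsM; apply: JM; apply/seteqP; split=> // a Ja; left; exact: JsM.
Qed.

(** The ideal [J] generated by [M] and [a] is everything, so the unit lies below [y ⊕ mv_iter k a]
    for some [y] in [M]; residuation moves the multiple to the other side. *)
Lemma mv_maximal_archimedean M a : mv_maximal_ideal M -> ~ M a ->
  exists k, M (¬ mv_iter k a).
Proof.
move=> [[nM dnM adM] M1 maxM] Ma.
have M0 : M mv_zero by exact: mv_ideal0.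
pose J := [set x | exists2 y, M y & exists k, mv_le x (y ⊕ mv_iter k a)].
have idJ : mv_ideal J.
  split; first by exists mv_zero, mv_zero => //; exists 0%N; exact: mv_le0.
  - by move=> x y xy [z Mz [k yz]]; exists z => //; exists k; exact: mv_le_trans yz.
  move=> x y [x' Mx' [k xk]] [y' My' [l yl]].
  exists (x' ⊕ y'); first exact: adM.
  exists (k + l)%N; have := mv_leD xk yl; rewrite mv_iterD.
  by rewrite !mv_addA -[x' ⊕ _ ⊕ y']mv_addA [_ ⊕ y']mv_addC !mv_addA.
have MJ : M `<=` J.
  by move=> x Mx; exists x => //; exists 0%N; rewrite mv_addr0; exact: mv_lexx.
have Ja : J a.
  by exists mv_zero => //; exists 1%N; rewrite mv_add0 mv_iterS mv_addr0; exact: mv_lexx.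
have [JT|JT] := eqVneq J setT; last by rewrite -(maxM J idJ JT MJ) in Ma.
have [y My [k]] : J (¬ mv_zero) by rewrite JT.
rewrite mv_addC => /mv_le_sub.
have -> : ¬ mv_zero ⊖ mv_iter k a = ¬ mv_iter k a.
  by rewrite mv_mulC mv_sub0.
by exists k; exact: dnM My.
Qed.

(** If [b ⊖ a] is outside [M], some [¬ mv_iter k (b ⊖ a)] lies in [M]. By disjointness [a ⊖ b] is
    unchanged by subtracting that multiple, hence lies below its negation. *)
Lemma mv_maximal_prime M a b : mv_maximal_ideal M -> M (a ⊖ b) \/ M (b ⊖ a).
Proof.
move=> maxM; have [[_ dnM _] _ _] := maxM.
apply: contrapT => /not_orP[Mab Mba].
have [k Mk] := mv_maximal_archimedean maxM Mba.
apply: Mab; apply: dnM Mk.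
by rewrite -(mv_sub_iter k (mv_sub_disjoint a b)); exact: mv_leMr.
Qed.

Lemma semisimple_eq0 a : semisimple A ->
  (forall M, mv_maximal_ideal M -> M a) -> a = mv_zero.
Proof.
move=> ss H; have : (\bigcap_(M in @mv_maximal_ideal A) M) a by exact: H.
by rewrite ss.
Qed.

End Ideals.

(** * Characters of an MV-algebra *)

Section Characters.
Variable R : realType.

(** Archimedean principle: a positive [x] would give [2 ^ n > n > 1 / x] for some [n]. It turns
    doubling of a bounded gap into an inequality. *)
Lemma le0_doubling (x : R) : (forall n, x * 2 ^+ n <= 1) -> x <= 0.
Proof.
move=> H; rewrite leNgt; apply/negP => x0.
have := archi_boundP (_ : 0 <= x^-1); rewrite invr_ge0 (ltW x0) => /(_ isT).
set n := Num.bound _ => xn; have := H n; apply/negP; rewrite -ltNge.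
have nx : n%:R < (2 : R) ^+ n by rewrite -natrX ltr_nat ltn_expl.
by rewrite -ltr_pdivrMl // mulr1 (lt_trans xn).
Qed.

(** Values are taken in [R] to keep real arithmetic direct; the bounds 0 and 1 follow from the
    clauses on sum and negation. *)
Definition mv_character (A : mvAlgType) (chi : A -> R) : Prop :=
  [/\ chi mv_zero = 0,
      forall a b, chi (a ⊕ b) = Num.min (chi a + chi b) 1 &
      forall a, chi (¬ a) = 1 - chi a].

Section OneCharacter.
Variables (A : mvAlgType) (chi : A -> R).
Hypothesis chiP : mv_character chi.
Implicit Types a b : A.

Lemma mv_char0 : chi mv_zero = 0.
Proof. by case: chiP. Qed.

Lemma mv_charD a b : chi (a ⊕ b) = Num.min (chi a + chi b) 1.
Proof. by case: chiP. Qed.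

Lemma mv_charN a : chi (¬ a) = 1 - chi a.
Proof. by case: chiP. Qed.

Lemma mv_char_le1 a : chi a <= 1.
Proof. by rewrite -(mv_addr0 a) mv_charD ge_min lexx orbT. Qed.

Lemma mv_char_ge0 a : 0 <= chi a.
Proof. by have := mv_char_le1 (¬ a); rewrite mv_charN; lra. Qed.

Lemma mv_charB a b : chi (a ⊖ b) = Num.max (chi a - chi b) 0.
Proof.
rewrite /mv_mul mv_negK mv_charN mv_charD mv_charN /Num.min /Num.max.
by do 2 case: ifPn; rewrite -?leNgt; lra.
Qed.

Lemma mv_charM a b : chi (a ⊙ b) = Num.max (chi a + chi b - 1) 0.
Proof. by rewrite -{1}(mv_negK b) mv_charB mv_charN opprB addrA addrAC. Qed.

Lemma mv_char_mono a b : mv_le a b -> chi a <= chi b.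
Proof.
move=> ab; have := mv_charB a b; rewrite ab mv_char0 => /esym/eqP.
by rewrite eq_maxr subr_le0.
Qed.

Lemma mv_char_ideal : mv_ideal [set a | chi a = 0].
Proof.
split; first by exists mv_zero; exact: mv_char0.
  move=> a b /mv_char_mono ab /= b0; apply/le_anti.
  by rewrite mv_char_ge0 -b0 ab.
by move=> a b /= a0 b0; rewrite mv_charD a0 b0 addr0 min_l.
Qed.

End OneCharacter.

Lemma mv_char_comp (A B : mvAlgType) (f : mv_hom A B) (chi : B -> R) :
  mv_character chi -> mv_character (chi \o f).
Proof.
by case=> c0 cD cN; split=> [|a b|a] /=; rewrite ?(mv_hom0, mv_homD, mv_homN).
Qed.

(* A gap between the two characters below [1/2] or above [1/2] is doubled by
   [a ⊕ a] or [a ⊙ a]; a gap across [1/2] contradicts the kernel inclusion. *)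
Lemma mv_char_ker_inj (A : mvAlgType) (chi psi : A -> R) :
  mv_character chi -> mv_character psi ->
  (forall a, chi a = 0 -> psi a = 0) -> chi =1 psi.
Proof.
move=> chiP psiP ker.
have gap n a : chi a < psi a -> (psi a - chi a) * 2 ^+ n <= 1.
  elim: n a => [|n IH] a lt.
    have := mv_char_ge0 chiP a; have := mv_char_le1 psiP a.
    by rewrite expr0 mulr1; lra.
  have [p2|p2] := leP (psi a) (1 / 2).
    have := IH (a ⊕ a); rewrite !mv_charD // !min_l; [|lra|lra].
    by rewrite exprS => /(_ ltac:(lra)); lra.
  have [c2|c2] := leP (1 / 2) (chi a).
    have := IH (a ⊙ a); rewrite !mv_charM // !max_l; [|lra|lra].
    by rewrite exprS => /(_ ltac:(lra)); lra.
  have /ker : chi (a ⊙ a) = 0 by rewrite mv_charM // max_r //; lra.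
  by rewrite mv_charM // max_l; lra.
have le a : psi a <= chi a.
  rewrite leNgt; apply/negP => lt.
  by have := le0_doubling (fun n => gap n a lt); lra.
move=> a; apply/le_anti; rewrite le andbT.
by have := le (¬ a); rewrite !mv_charN //; lra.
Qed.

End Characters.

(** * Truncation of reals to the unit interval *)

Section Clip.
Variable R : realType.
Implicit Types (s t : R) (r : {i01 R}).

Definition clip t : R := Num.max 0 (Num.min t 1).

Lemma clip_ge0 t : 0 <= clip t.
Proof. by rewrite /clip le_max lexx. Qed.

Lemma clip_le1 t : clip t <= 1.
Proof. by rewrite /clip ge_max ler01 ge_min lexx orbT. Qed.

Definition clip01 t : {i01 R} := Itv01 (clip_ge0 t) (clip_le1 t).

Lemma clip_id t : 0 <= t <= 1 -> clip t = t.
Proof. by move=> /andP[t0 t1]; rewrite /clip min_l // max_r. Qed.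

Lemma clip01K r : clip01 r%:num = r.
Proof. by apply: val_inj; rewrite /= clip_id // ge0 le1. Qed.

Lemma clip01_max s t : 0 <= s <= 1 -> 0 <= t <= 1 ->
  (Num.max ((clip01 s)%:num - (clip01 t)%:num) 0)%:i01 = clip01 (s - t).
Proof.
move=> s01 t01; apply: val_inj; rewrite /= !(clip_id s01, clip_id t01) /clip.
by rewrite min_l 1?maxC //; lra.
Qed.

End Clip.

(** * Homogeneity of characters, and scalar multiples of the unit *)

Section RieszCharacters.
Variables (R : realType) (V : rieszMVType R).
Implicit Types (r q : {i01 R}) (a b v : V).

(** Along [t], the value [phi t] respects differences and stays bounded. Doubling the gap shows that
    it never exceeds the linear function [t * phi 1]. *)
Lemma mv_char_scale (chi : V -> R) r a : mv_character chi ->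
  chi (mv_scale r a) = r%:num * chi a.
Proof.
move=> chiP; pose phi t := chi (mv_scale (clip01 t) a).
have phi1 : phi 1 = chi a.
  rewrite /phi (_ : clip01 1 = 1%:i01) ?mv_scale1 //.
  by apply: val_inj; rewrite /= clip_id // ler01 lexx.
have phiM s t : 0 <= s <= 1 -> 0 <= t <= 1 -> phi (s - t) = Num.max (phi s - phi t) 0.
  by move=> s01 t01; rewrite /phi -clip01_max // mv_scaleBl mv_charB.
have phi0 t : t <= 0 -> phi t = 0.
  move=> t0; have -> : phi t = phi (1 - 1).
    rewrite subrr /phi; congr (chi (mv_scale _ a)); apply: val_inj.
    by rewrite /= /clip !min_l ?max_l //; lra.
  by rewrite phiM ?subrr ?maxxx ?ler01 ?lexx.
have phiB s t : 0 <= t <= s -> s <= 1 -> phi (s - t) = phi s - phi t.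
  move=> /andP[t0 ts] s1.
  have s01 : 0 <= s <= 1 by lra.
  have t01 : 0 <= t <= 1 by lra.
  rewrite phiM // max_l // subr_ge0.
  (* Vanishing at [t - s] means [phi t <= phi s], so the truncation is inactive. *)
  have : phi (t - s) = 0 by apply: phi0; lra.
  by rewrite phiM // => /eqP; rewrite eq_maxr subr_le0.
have phi_ge0 t : 0 <= phi t by exact: mv_char_ge0.
have phi_le1 t : phi t <= 1 by exact: mv_char_le1.
have gap n t : 0 <= t <= 1 -> (phi t - t * phi 1) * 2 ^+ n <= 1.
  elim: n t => [|n IH] t t01.
    have := phi_le1 t; have : 0 <= t * phi 1 by rewrite mulr_ge0 //; lra.
    by rewrite expr0 mulr1; lra.
  have [t2|t2] := leP t (1 / 2).
    have := IH (2 * t) ltac:(lra).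
    have : phi (2 * t - t) = phi (2 * t) - phi t by apply: phiB; lra.
    rewrite (_ : 2 * t - t = t); last by lra.
    move=> E; have -> : phi (2 * t) = 2 * phi t by lra.
    by rewrite exprS; lra.
  (* At [2 * t - 1] the gap is again twice the gap at [t], since [phi (1 - t) = phi 1 - phi t]. *)
  have := IH (t - (1 - t)) ltac:(lra).
  rewrite !phiB; [|lra..].
  by rewrite exprS; lra.
have le t : 0 <= t <= 1 -> phi t <= t * phi 1.
  by move=> t01; have := le0_doubling (fun n => gap n t t01); lra.
have r01 : 0 <= r%:num <= 1 by rewrite ge0 le1.
rewrite -[in LHS](clip01K r) -/(phi _) -phi1; apply/le_anti; rewrite le //=.
(* The upper bound at the complementary scalar is the missing lower bound at [r]. *)
have := le (1 - r%:num) ltac:(lra); rewrite phiB; lra.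
Qed.

(** Truncation makes this total on [R], so that cuts may range over all reals. *)
Definition scalar t : V := mv_scale (clip01 t) (¬ mv_zero).

Lemma scalar1 t : 1 <= t -> scalar t = ¬ mv_zero.
Proof.
move=> t1; rewrite /scalar (_ : clip01 t = 1%:i01) ?mv_scale1 //.
by apply: val_inj; rewrite /= /clip min_r // max_r.
Qed.

Lemma scalarB s t : 0 <= s <= 1 -> 0 <= t <= 1 ->
  scalar s ⊖ scalar t = scalar (s - t).
Proof. by move=> s01 t01; rewrite /scalar -mv_scaleBl clip01_max. Qed.

Lemma scalar_clip t : scalar (clip t) = scalar t.
Proof.
rewrite /scalar; congr mv_scale; apply: val_inj.
by rewrite /= clip_id // clip_ge0 clip_le1.
Qed.

Lemma scalar0 t : t <= 0 -> scalar t = mv_zero.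
Proof.
move=> t0; rewrite -scalar_clip.
have -> : clip t = 1 - 1 by rewrite subrr /clip min_l ?max_l //; lra.
by rewrite -scalarB ?ler01 ?lexx // mv_mulrN.
Qed.

Lemma scalar_le s t : s <= t -> mv_le (scalar s) (scalar t).
Proof.
move=> st; rewrite /mv_le -(scalar_clip s) -(scalar_clip t).
rewrite scalarB ?clip_ge0 ?clip_le1 // scalar0 // subr_le0 /clip.
by rewrite ge_max !le_max lexx /= le_min !ge_min st lexx !orbT.
Qed.

Lemma scalarN t : ¬ scalar t = scalar (1 - t).
Proof.
rewrite -[in RHS]scalar_clip (_ : clip (1 - t) = 1 - clip t); last first.
  rewrite /clip /Num.max /Num.min.
  by do !case: ifPn; rewrite -?leNgt; lra.
rewrite -scalarB ?ler01 ?lexx ?clip_ge0 ?clip_le1 // scalar_clip (scalar1 (lexx 1)).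
by rewrite mv_mulC mv_sub0.
Qed.

Lemma scalarD s t : 0 <= s -> 0 <= t -> scalar s ⊕ scalar t = scalar (s + t).
Proof.
move=> s0 t0.
have [s1|s1] := leP 1 s; first by rewrite (scalar1 s1) mv_add1 scalar1 ?ler_wpDr.
have [t1|t1] := leP 1 t; first by rewrite mv_addC (scalar1 t1) mv_add1 scalar1 ?ler_wpDl.
have -> : scalar s ⊕ scalar t = ¬ (¬ scalar s ⊖ scalar t).
  by rewrite /mv_mul !mv_negK.
by rewrite (scalarN s) scalarB ?scalarN; [congr scalar|..]; lra.
Qed.

End RieszCharacters.

(** * The character whose kernel is a given maximal ideal *)

Section MaximalCharacter.
Variables (R : realType) (V : rieszMVType R) (N : set V).
Hypothesis maxN : mv_maximal_ideal N.
Implicit Types (s t x y : R) (a b c v : V).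

Let idN : mv_ideal N. Proof. by case: maxN. Qed.
Let N0 : N mv_zero. Proof. exact: mv_ideal0. Qed.
Let dnN a b : mv_le a b -> N b -> N a. Proof. by case: idN => _ + _; apply. Qed.
Let adN a b : N a -> N b -> N (a ⊕ b). Proof. by case: idN => _ _; apply. Qed.
Let N1 : ~ N (¬ mv_zero).
Proof. by case: maxN => _ + _; exact: mv_ideal_proper. Qed.

(** The order of the quotient by [N], used without forming the quotient. *)
Local Notation "a ≲ b" := (N (a ⊖ b)) (at level 70).
Local Notation E := (@scalar R V).

Let le_leN a b : mv_le a b -> a ≲ b. Proof. by move=> ->. Qed.

Let leN_trans b a c : a ≲ b -> b ≲ c -> a ≲ c.
Proof. by move=> ab bc; apply: dnN (mv_sub_trans b a c) _; exact: adN. Qed.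

Let leND a b c d : a ≲ b -> c ≲ d -> a ⊕ c ≲ b ⊕ d.
Proof. by move=> ab cd; apply: dnN (mv_subD a c b d) _; exact: adN. Qed.

(** Repeated doubling inside [N] would otherwise reach the unit. *)
Lemma scalar_notin t : 0 < t -> ~ N (E t).
Proof.
move=> t0 Nt; suff /le0_doubling : forall n, t * 2 ^+ n <= 1 by lra.
have NE n : N (E (t * 2 ^+ n)).
  elim: n => [|n IH]; first by rewrite expr0 mulr1.
  have -> : t * 2 ^+ n.+1 = t * 2 ^+ n + t * 2 ^+ n by rewrite exprS; lra.
  by rewrite -scalarD ?mulr_ge0 ?exprn_ge0 ?(ltW t0) //; exact: adN.
move=> n; rewrite leNgt; apply/negP => /ltW n1; apply: N1.
by rewrite -(scalar1 V n1).
Qed.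

(* [x] is the Dedekind cut of [v] among the scalars, modulo [N]. *)
Let cut v x := [/\ 0 <= x <= 1, forall t, t < x -> E t ≲ v &
  forall t, x < t -> v ≲ E t].

Let cut_le v x y : cut v x -> cut v y -> y <= x.
Proof.
move=> [x01 _ xv] [y01 yv _]; rewrite leNgt; apply/negP => xy.
(* With a third of the gap, [y - d] and [x + d] still differ by [d]; squeezing [v] between their
   scalars puts [E d] in [N]. *)
pose d := (y - x) / 3; have d0 : 0 < d by rewrite /d; lra.
apply: (scalar_notin d0).
have yx : y = x + d * 3 by rewrite /d; lra.
have -> : E d = E (y - d) ⊖ E (x + d) by rewrite scalarB; [congr scalar|..]; lra.
by apply: (@leN_trans v); [apply: yv | apply: xv]; lra.
Qed.

Let cut_unique v x y : cut v x -> cut v y -> x = y.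
Proof. by move=> vx vy; apply/le_anti; rewrite !(@cut_le v). Qed.

Let below v := [set t | 0 <= t <= 1 /\ E t ≲ v].

Definition maximal_char v : R := sup (below v).

Let maximal_charP v : cut v (maximal_char v).
Proof.
have b0 : below v 0.
  by split; [rewrite lexx ler01 | rewrite scalar0 //; apply/le_leN/mv_le0].
have ub : ubound (below v) 1 by move=> t [/andP[]].
have ne : below v !=set0 by exists 0.
have x1 : maximal_char v <= 1 by exact: ge_sup.
have ubsup : ubound (below v) (maximal_char v).
  by apply: ub_le_sup; exists 1.
have x0 : 0 <= maximal_char v by exact: ubsup.
split=> [|t lt|t lt]; first by rewrite x0.
  have [s [_ sv] /ltW ts] := sup_gt ne lt.
  by apply: leN_trans sv; apply/le_leN/scalar_le.
have [t1|t1] := leP 1 t; first by rewrite scalar1 //; apply/le_leN/mv_le1.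
(* Primality makes the quotient totally ordered; the unwanted case would put [t] in [below v] above
   its supremum. *)
have [tv|//] := mv_maximal_prime (E t) v maxN.
have /ubsup : below v t by split=> //; lra.
by lra.
Qed.

Let maximal_charE v x : cut v x -> maximal_char v = x.
Proof. exact: cut_unique. Qed.

Lemma maximal_char_character : mv_character maximal_char.
Proof.
split=> [|a b|a].
- apply: maximal_charE; split=> [|t t0|t t0]; first by rewrite lexx ler01.
    by rewrite scalar0 ?(ltW t0) // mv_mulrN.
  by apply/le_leN/mv_le0.
- have [] := maximal_charP a; have [] := maximal_charP b.
  move: (maximal_char a) (maximal_char b) => x y y01 yb by_ x01 xa ax.
  apply: maximal_charE; split.
  + by rewrite le_min ler01 ge_min lexx orbT !andbT; lra.
  + move=> t; rewrite lt_min => /andP[txy t1].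
    pose d := (x + y - t) / 2; have d0 : 0 < d by rewrite /d; lra.
    have tE : t = x + y - d * 2 by rewrite /d; lra.
    apply: leN_trans (leND (xa (x - d) _) (yb (y - d) _)); [|lra..].
    (* [x - d] or [y - d] may be negative, while [scalarD] needs nonnegative arguments. *)
    rewrite -(scalar_clip _ (x - d)) -(scalar_clip _ (y - d)).
    rewrite scalarD ?clip_ge0 //; apply/le_leN/scalar_le.
    by rewrite /clip !min_l; [rewrite /Num.max; do 2 case: ifPn; rewrite -?leNgt; lra | lra..].
  move=> t; rewrite gt_min => /orP[txy|t1]; last first.
    by rewrite scalar1 ?(ltW t1) //; apply/le_leN/mv_le1.
  pose d := (t - (x + y)) / 2; have d0 : 0 < d by rewrite /d; lra.
  have -> : t = (x + d) + (y + d) by rewrite /d; lra.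
  by rewrite -scalarD; [apply: leND; [apply: ax | apply: by_]|..]; lra.
have [] := maximal_charP a; move: (maximal_char a) => x x01 xa ax.
apply: maximal_charE; split=> [|t tx|t tx]; first by lra.
  (* Negation reverses the order and exchanges the two halves of the cut. *)
  have -> : t = 1 - (1 - t) by lra.
  by rewrite -scalarN mv_subN; apply: ax; lra.
have -> : t = 1 - (1 - t) by lra.
by rewrite -scalarN mv_subN; apply: xa; lra.
Qed.

(** A [v] outside [N] has some [¬ mv_iter k v] in [N]; were its value zero, that negation would have
    both value 0 and value 1. *)
Lemma maximal_char_eq0 v : maximal_char v = 0 <-> N v.
Proof.
have N_eq0 a : N a -> maximal_char a = 0.
  move=> Na; apply: maximal_charE; split=> [|t t0|t t0].
  - by rewrite lexx ler01.
  - by rewrite scalar0 ?(ltW t0) //; apply/le_leN/mv_le0.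
  by apply: dnN Na; exact: mv_leMl.
split=> [v0|]; last exact: N_eq0.
have chiP := maximal_char_character.
apply: contrapT => Nv; have [k /N_eq0] := mv_maximal_archimedean maxN Nv.
rewrite (mv_charN chiP); suff -> : maximal_char (mv_iter k v) = 0 by lra.
elim: k => [|k IH]; first exact: (mv_char0 chiP).
by rewrite mv_iterS (mv_charD chiP) v0 IH addr0 min_l.
Qed.

End MaximalCharacter.

(** Equal values put [v ⊖ w] in the kernel of every [maximal_char], hence in every maximal ideal;
    symmetry gives the other inequality. *)
Lemma semisimple_char_inj (R : realType) (W : rieszMVType R) (v w : W) :
  semisimple W ->
  (forall chi : W -> R, mv_character chi -> chi v = chi w) -> v = w.
Proof.
move=> ss; wlog suff le : v w / (forall chi : W -> R, mv_character chi ->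
    chi v = chi w) -> mv_le v w.
  move=> H; apply: mv_le_anti; apply: le => // chi chiP.
  by rewrite H.
move=> H; apply: semisimple_eq0 => // M maxM.
have chiP := maximal_char_character maxM.
by apply/(maximal_char_eq0 maxM); rewrite mv_charB // H // subrr maxxx.
Qed.

(** Composing [g] with a character of [W] gives a character of [V], and both are homogeneous. *)
Lemma semisimple_hom_scale (R : realType) (V W : rieszMVType R)
  (g : mv_hom V W) (r : {i01 R}) v : semisimple W ->
  g (mv_scale r v) = mv_scale r (g v).
Proof.
move=> ss; apply: semisimple_char_inj ss _ => chi chiP.
have := mv_char_scale r v (mv_char_comp g chiP) => /= ->.
by rewrite mv_char_scale.
Qed.

(** * The universal property of the Riesz hull *)

Section RieszHull.
Variables (R : realType) (A : mvAlgType) (V : rieszMVType R).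
Variables (iota : mv_hom A V).
Hypothesis hull : is_riesz_hull iota.

Lemma riesz_hull_inj : injective iota.
Proof.
case: hull => G [phi [Gd [j [C [e [k]]]]]] /=.
move=> [[phib [jinj _ _] [einj _ _]] [_ _ _ kE]] a b ab.
apply: (bij_inj phib); have := kE b; rewrite -ab kE /= => /einj.
by move=> /(congr1 val) /= /jinj; exact: val_inj.
Qed.

Lemma riesz_hull_ind (S : set V) :
  riesz_subalgebra S -> (forall a, S (iota a)) -> forall v, S v.
Proof.
case: hull => G [phi [Gd [j [C [e [k]]]]]] /=.
move=> [_ [kinj kZ kV kE]] [S0 SD SN SZ] Siota v.
suff : range k `<=` k @` S by move=> /(_ (k v) (imageT _ _))[w Sw /kinj <-].
rewrite kV; apply: smallest_sub; last first.
  by move=> _ [a _ <-]; exists (iota a); rewrite // kE.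
split.
- by exists mv_zero; rewrite ?mv_hom0.
- move=> _ _ [a Sa <-] [b Sb <-]; exists (a ⊕ b); last by rewrite mv_homD.
  exact: SD.
- by move=> _ [a Sa <-]; exists (¬ a); [exact: SN | rewrite mv_homN].
- by move=> r _ [a Sa <-]; exists (mv_scale r a); [exact: SZ | rewrite kZ].
Qed.

Lemma mv_char_extend (chi : A -> R) : mv_character chi ->
  exists2 psi : V -> R, mv_character psi & psi \o iota =1 chi.
Proof.
move=> chiP; pose I := [set v | exists2 a, chi a = 0 & mv_le v (iota a)].
have [_ dn ad] := mv_char_ideal chiP.
have idI : mv_ideal I.
  split; first by exists mv_zero, mv_zero; [exact: mv_char0 | exact: mv_le0].
  - by move=> v w vw [a a0 wa]; exists a => //; exact: mv_le_trans wa.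
  move=> v w [a a0 va] [b b0 wb]; exists (a ⊕ b); first exact: ad.
  by rewrite mv_homD; exact: mv_leD.
have I1 : ~ I (¬ mv_zero).
  (* Injectivity of [iota] forces [a] to be the unit, where [chi] is 1 and not 0. *)
  move=> [a a0 le1]; have : a = ¬ mv_zero.
    apply: riesz_hull_inj; rewrite mv_homN mv_hom0.
    by apply: mv_le_anti => //; exact: mv_le1.
  by move=> aE; move: a0; rewrite aE mv_charN // mv_char0 // subr0; lra.
have [N maxN IN] := mv_maximal_exists idI I1.
have psiP := maximal_char_character maxN.
exists (maximal_char N) => // a; apply: esym.
(* Characters with nested kernels coincide, so it suffices that [iota] sends the kernel of [chi]
   into [N]. *)
apply: (mv_char_ker_inj chiP (mv_char_comp iota psiP)) => {}a a0.
apply/(maximal_char_eq0 maxN)/IN; exists a => //; exact: mv_lexx.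
Qed.

Section Universal.
Variables (W : rieszMVType R).
Hypothesis ssW : semisimple W.

(** The elements where [g1] and [g2] agree form a Riesz subalgebra; closure under scalars is
    [semisimple_hom_scale]. *)
Lemma riesz_hull_ext (g1 g2 : mv_hom V W) :
  mv_comp g1 iota = mv_comp g2 iota -> g1 = g2.
Proof.
move=> g12; apply: mv_hom_eq; apply: riesz_hull_ind; last first.
  by move=> a; have := congr1 (fun h : mv_hom A W => h a) g12.
split=> [|a b|a|r a] /=; first by rewrite !mv_hom0.
- by rewrite !mv_homD => -> ->.
- by rewrite !mv_homN => ->.
- by rewrite !semisimple_hom_scale // => ->.
Qed.

Variable f : mv_hom A W.

(* Relates [v] to its image [w] under the extension of [f] to [V]: every
   character of [W] has a compatible one on [V], so [w] is determined by [v]. *)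
Let rel v w := forall (psi : V -> R) (chi : W -> R),
  mv_character psi -> mv_character chi -> psi \o iota =1 chi \o f ->
  psi v = chi w.

Let rel_fun v w1 w2 : rel v w1 -> rel v w2 -> w1 = w2.
Proof.
move=> v1 v2; apply: semisimple_char_inj ssW _ => chi chiP.
have [psi psiP E] := mv_char_extend (mv_char_comp f chiP).
by rewrite -(v1 psi chi) // -(v2 psi chi).
Qed.

Let rel0 : rel mv_zero mv_zero.
Proof. by move=> psi chi psiP chiP _; rewrite !mv_char0. Qed.

Let relD v1 v2 w1 w2 : rel v1 w1 -> rel v2 w2 -> rel (v1 ⊕ v2) (w1 ⊕ w2).
Proof.
move=> r1 r2 psi chi psiP chiP E; rewrite !mv_charD //.
by rewrite (r1 psi chi) // (r2 psi chi).
Qed.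

Let relN v w : rel v w -> rel (¬ v) (¬ w).
Proof.
by move=> vw psi chi psiP chiP E; rewrite !mv_charN // (vw psi chi).
Qed.

Let relZ r v w : rel v w -> rel (mv_scale r v) (mv_scale r w).
Proof.
by move=> vw psi chi psiP chiP E; rewrite !mv_char_scale // (vw psi chi).
Qed.

Let rel_iota a : rel (iota a) (f a).
Proof. by move=> psi chi _ _ /(_ a). Qed.

Let rel_total v : exists w, rel v w.
Proof.
apply: (@riesz_hull_ind [set v | exists w, rel v w]); last first.
  by move=> a; exists (f a); exact: rel_iota.
split=> [|a b [w aw] [w' bw']|a [w aw]|r a [w aw]].
- by exists mv_zero; exact: rel0.
- by exists (w ⊕ w'); exact: relD.
- by exists (¬ w); exact: relN.
- by exists (mv_scale r w); exact: relZ.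
Qed.

(** [rel] is total, functional and compatible with the operations, so a choice function for it is a
    homomorphism. *)
Lemma riesz_hull_universal : exists g : mv_hom V W, mv_comp g iota = f.
Proof.
have /choice[g gP] := rel_total.
have g0 : g mv_zero = mv_zero by exact: rel_fun (gP _) rel0.
have gD a b : g (a ⊕ b) = g a ⊕ g b.
  by apply: rel_fun (gP _) _; exact: relD.
have gN a : g (¬ a) = ¬ g a by apply: rel_fun (gP _) _; exact: relN.
exists (MVHom g0 gD gN); apply: mv_hom_eq => a /=.
exact: rel_fun (gP _) (rel_iota a).
Qed.

End Universal.
End RieszHull.

(** * The hull functor and the adjunction, from the universal arrows [iota A] *)

Theorem theorem5p1 (R : realType) (RH : MVs -> RMVs R)
    (iota : forall A : MVs, A ⟶ forget_obj (RH A))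
    (hull : forall A : MVs, is_riesz_hull (V := ssRieszMV_sort (RH A)) (iota A)) :
  exists RF : functor RH,
    (forall (A B : MVs) (h : A ⟶ B) (g : RH A ⟶ RH B),
       fmap (forget R) g ∘ iota A = iota B ∘ h <-> g = fmap RF h) /\
    left_adjoint RF (forget R).
Proof.
have univ (A : MVs) (W : RMVs R) (f : A ⟶ forget_obj W) :
    exists g : RH A ⟶ W, fmap (forget R) g ∘ iota A = f.
  exact: (riesz_hull_universal (hull A) (ssRieszMV_semisimple W)).
have ext (A : MVs) (W : RMVs R) (g1 g2 : RH A ⟶ W) :
    fmap (forget R) g1 ∘ iota A = fmap (forget R) g2 ∘ iota A -> g1 = g2.
  exact: (riesz_hull_ext (hull A) (ssRieszMV_semisimple W)).
pose Rf (A B : MVs) (h : A ⟶ B) : RH A ⟶ RH B :=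
  sval (cid (univ A (RH B) (iota B ∘ h))).
have RfP (A B : MVs) (h : A ⟶ B) : fmap (forget R) (Rf A B h) ∘ iota A = iota B ∘ h.
  exact: svalP (cid (univ A (RH B) (iota B ∘ h))).
have Rf_id A : Rf A A (idc A) = idc (RH A).
  by apply: (ext A (RH A)); rewrite RfP compc1r [RHS]compc1l.
have Rf_comp A B C (g : B ⟶ C) (f : A ⟶ B) : Rf A C (g ∘ f) = Rf B C g ∘ Rf A B f.
  apply: (ext A (RH C)); rewrite RfP compcA -RfP.
  by rewrite -compcA -RfP compcA fmap_comp.
exists (Functor Rf_id Rf_comp); split=> [A B h g|].
  split=> [E|->]; last exact: RfP.
  by apply: (ext A (RH B)); rewrite E RfP.
(* The bijection is restriction along the unit [iota A]: [univ] gives the inverse and [ext] its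
   uniqueness. Naturality in the first variable is [RfP]. *)
exists (fun A W (g : RH A ⟶ W) => fmap (forget R) g ∘ iota A); split.
  move=> A W; exists (fun f => sval (cid (univ A W f))) => [g|f].
    by apply: (ext A W); exact: svalP (cid (univ A W _)).
  exact: svalP (cid (univ A W f)).
move=> A A' W W' h k g; by rewrite !fmap_comp -!compcA RfP.
Qed.
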